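(* Let $X_1,\dots,X_n$ be topological spaces and, for $1\le i\le n$, let $K_i$ be a fixed compactification of $X_i$. Let $\mu Z$ be a complete uniform space and let $g:\prod_{1\le i\le n}X_i\to\mu Z$ be a continuous map such that for every $1\le j\le n$: (a) for every $\overrightarrow{x}=(x_i)_{i\ne j}\in\prod_{1\le i\le n,\ i\ne j}X_i$, the map $g_{\overrightarrow{x}}:X_j\to\mu Z$, $g_{\overrightarrow{x}}(x_j)=g(x_1,\dots,x_n)$, can be extended to a continuous map $\overline g_{\overrightarrow{x}}:K_j\to\mu Z$; and (b) the set $\{g_{x_j}:x_j\in X_j\}$, where $g_{x_j}:\prod_{1\le i\le n,\ i\neq j}X_i\to\mu Z$ is the map obtained from $g$ by fixing the $j$-th coordinate equal to $x_j$, is relatively compact in $C_\infty\big(\prod_{1\le i\le n,\ i\ne j}X_i,\mu Z\big)$. Then $g$ can be extended to a continuous map $\overline g:\prod_{1\le i\le n}K_i\to\mu Z$.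
   Context: A compactification $K$ of a topological space $X$ is here a compact Hausdorff space $K$ containing $X$ as a dense subspace. A uniform space $\mu Z$ is a set $Z$ with a uniformity $\mu$ (given by a set of entourages, called vicinities, of the diagonal of $Z\times Z$), carrying the topology induced by $\mu$. For a topological space $Y$, $C_\infty(Y,\mu Z)$ is the set of all continuous functions from $Y$ to $\mu Z$ with the topology of uniform convergence: basic neighbourhoods of $g$ are the sets $\{h\in C_\infty(Y,\mu Z):(g(y),h(y))\in B\text{ for all }y\in Y\}$, with $B\in\mu$. *)

(* Defs.v *)
From mathcomp Require Import all_boot all_classical topology.

Set Implicit Arguments.
Unset Strict Implicit.
Unset Printing Implicit Defensive.

Local Open Scope classical_set_scope.

(* The inclusion of X into K is an explicit map iota; the topology of X is the
   one induced by K along iota. *)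
Record compactification (X K : topologicalType) (iota : X -> K) : Prop :=
  Compactification {
    compactification_compact : compact [set: K];
    compactification_hausdorff : hausdorff_space K;
    compactification_inj : injective iota;
    compactification_subspace :
      forall U : set X, open U <-> exists2 V : set K, open V & iota @^-1` V = U;
    compactification_dense : dense (range iota)
  }.

(* This is the axiom of completeType, which however is restricted to pointed
   spaces: there, cvg F is stated with a total limit operator. Neither
   nonemptiness nor separation is assumed here. *)
Definition complete_uniform (Z : uniformType) : Prop :=
  forall F : set_system Z, ProperFilter F -> cauchy F -> exists z : Z, F --> z.

(* arrow_uniform_type Y Z is Y -> Z with the uniformity of uniform convergence;
   the continuous maps get the topology induced from it. *)
Definition Cinfty (Y : topologicalType) (Z : uniformType) : uniformType :=
  initial_topology
    (fun f : continuousType Y Z => (f : Y -> Z) : arrow_uniform_type Y Z).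

Lemma nbhs_CinftyP (Y : topologicalType) (Z : uniformType) (g : Cinfty Y Z)
    (A : set (Cinfty Y Z)) :
  nbhs g A <-> exists2 B : set (Z * Z), entourage B &
    [set h : Cinfty Y Z | forall y, B ((g : continuousType Y Z) y,
                                       (h : continuousType Y Z) y)] `<=` A.
Proof.
rewrite -nbhs_entourageE; split.
  move=> [V [W [B eB sB] sV] sA]; exists B => // h hB.
  by apply: sA; apply/xsectionP/sV => /=; exact: sB.
move=> [B eB sA].
exists [set fh : Cinfty Y Z * Cinfty Y Z | forall y,
   B ((fh.1 : continuousType Y Z) y, (fh.2 : continuousType Y Z) y)].
  exists [set fh : (Y -> Z) * (Y -> Z) | forall y, B (fh.1 y, fh.2 y)] => //.
  by exists B.
by move=> h /xsectionP; exact: sA.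
Qed.

Section Products.
Context {I : eqType}.

Definition others (j : I) : Type := {i : I | i != j}.

Definition prod_others (X : I -> topologicalType) (j : I) :
    topologicalType :=
  prod_topology (fun k : others j => X (val k)).

Context (X : I -> topologicalType) (j : I).

(* The point whose j-th coordinate is a and whose other coordinates are x. *)
Definition insert_coord (a : X j) (x : prod_others X j) : prod_topology X :=
  fun i => match eq_comparable i j with
           | left e => ecast k (X k) (esym e) a
           | right ne => x (exist _ i (introN eqP ne))
           end.

Lemma insert_coord_at (a : X j) (x : prod_others X j) :
  insert_coord a x j = a.
Proof.
rewrite /insert_coord; case: eq_comparable => // e.
by rewrite (eq_irrelevance e erefl).
Qed.

Lemma insert_coord_other (a : X j) (x : prod_others X j) (k : others j) :
  insert_coord a x (val k) = x k.
Proof.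
rewrite /insert_coord; case: k => i /= ne.
case: eq_comparable => [e|ne']; first by exfalso; rewrite e eqxx in ne.
by congr (x (exist _ _ _)); exact: bool_irrelevance.
Qed.

Lemma continuous_prod (T : topologicalType) (f : T -> prod_topology X) :
  (forall i, continuous (fun t => f t i)) -> continuous f.
Proof.
move=> cf t; apply/cvg_sup => i A.
rewrite nbhsE => -[_ [[V oV <-] /= Vft] sA].
apply: (@filterS _ _ _ ((fun t => f t i) @^-1` V)).
  by move=> s Vs; exact: sA.
by apply: (cf i t); apply: open_nbhs_nbhs.
Qed.

Lemma insert_coord_continuous (a : X j) : continuous (insert_coord a).
Proof.
apply: continuous_prod => i; rewrite /insert_coord; case: eq_comparable => [e|ne].
  exact: cst_continuous.
exact: (@proj_continuous _ (fun k : others j => X (val k)) (exist _ i _)).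
Qed.

Definition slice (Z : uniformType) (g : continuousType (prod_topology X) Z)
    (a : X j) : Cinfty (prod_others X j) Z :=
  (g \o mkcts (@insert_coord_continuous a) : continuousType _ _).

Lemma sliceE (Z : uniformType) (g : continuousType (prod_topology X) Z)
    (a : X j) (x : prod_others X j) :
  (slice g a : continuousType _ _) x = g (insert_coord a x).
Proof. by []. Qed.

End Products.

(* Main.v *)
Require Import Defs.
From mathcomp Require Import all_boot all_classical topology.

Local Open Scope classical_set_scope.

(** A point of the product of the [K i] has a trace filter on the product of the
    [X i]; by completeness, [g] extends as soon as it maps each of these filters
    to a Cauchy filter. Moving from one point to another one coordinate at a
    time, it suffices that near every [c : K j] the slices of [g] at [a : X j]
    are uniformly close to one another. If they were not, then, by relative
    compactness, slices at points [a] tending to [c] but staying uniformly far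
    from [y |-> h y c], where [h y] extends [a |-> g (a, y)] to [K j], would
    cluster uniformly at some [f]; as they converge pointwise to [h y c], the
    values [f y] and [h y c] are inseparable, a contradiction. *)

Lemma precompact_range_uniformly_cauchy (S K Y : topologicalType)
    (Z : uniformType) (e : S -> K) (s : S -> Cinfty Y Z) (c : K)
    (B : set (Z * Z)) :
  precompact (range s) ->
  (forall y, exists h : continuousType K Z,
    forall a, h (e a) = (s a : continuousType Y Z) y) ->
  entourage B ->
  exists2 U : set K, nbhs c U & forall a b, U (e a) -> U (e b) -> forall y,
    B ((s a : continuousType Y Z) y, (s b : continuousType Y Z) y).
Proof.
rewrite precompactE => cs /choice[h hE] eB.
pose D : set (Z * Z) := split_ent B `&` (split_ent B)^-1%relation.
have eD : entourage D.
  by apply: filterI; [|apply: entourage_inv]; exact: entourage_split_ent.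
pose A : set S :=
  [set a | forall y, D (h y c, (s a : continuousType Y Z) y)].
suff [U cU UA] : exists2 U, nbhs c U & forall a, U (e a) -> A a.
  exists U => // a b Ua Ub y.
  have [_ ?] := UA _ Ua y; have [? _] := UA _ Ub y.
  exact: (entourage_split (h y c)).
apply: contrapT => notA.
(* The slices at points near [c] but outside [A]. The filter is proper exactly because [notA]
   forbids a neighbourhood of [c] whose trace lies in [A]. *)
pose F := filter_from (nbhs c) (fun U => s @` (e @^-1` U `&` ~` A)).
have FF : ProperFilter F.
  apply: filter_from_proper.
    apply: filter_from_filter; first by exists setT; exact: filterT.
    move=> U V cU cV; exists (U `&` V); first exact: filterI.
    by move=> _ [a [[Ua Va] nAa] <-]; split; exists a.
  move=> U cU; apply: contrapT => U0; apply: notA; exists U => // a Ua.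
  by apply: contrapT => nAa; apply: U0; exists (s a); exists a.
have [|f [_ Ff]] := cs F FF.
  exists setT; first exact: filterT.
  by move=> _ [a _ <-]; apply: subset_closure; exists a.
pose E := split_ent (split_ent D).
have eE : entourage E by do 2 apply: entourage_split_ent.
pose E' : set (Z * Z) := E `&` E^-1%relation.
have eE' : entourage E' by apply: filterI => //; exact: entourage_inv.
have near_f : nbhs f [set u : Cinfty Y Z | forall y,
    E' ((f : continuousType Y Z) y, (u : continuousType Y Z) y)].
  by apply/nbhs_CinftyP; exists E'.
(* The point [a] found below depends on [y], but the entourage does not: the pointwise comparison of
   [h y c] with [f y] is therefore uniform in [y]. *)
have hf y : split_ent D (h y c, (f : continuousType Y Z) y).
  have cU : nbhs c (h y @^-1` xsection E (h y c)).
    by apply: cts_fun; rewrite -nbhs_entourageE; exists E.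
  have [] := Ff _ _ (ex_intro2 _ _ _ cU (fun _ => id)) near_f.
  move=> _ [[a [/xsectionP + _] <-] /(_ y)[_ fa]]; rewrite hE => ha.
  by apply: (entourage_split _ _ ha fa); exact: entourage_split_ent.
(* Some slice at a point outside [A] is uniformly close to [f], hence to [h y c] for all [y], which
   puts that point in [A]. *)
have FA : F (s @` (~` A)).
  by exists setT; [exact: filterT|move=> _ [a [_ nAa] <-]; exists a].
have [_ [[a nAa <-] fa]] := Ff _ _ FA near_f.
apply: nAa => y; apply: (entourage_split _ eD (hf y)).
by apply: split_ent_subset; [exact: entourage_split_ent|case: (fa y)].
Qed.

Lemma dense_extension (T L : topologicalType) (Z : uniformType) (e : T -> L)
    (g : T -> Z) :
  complete_uniform Z -> injective e -> dense (range e) ->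
  (forall (k : L) B, entourage B -> exists2 U : set L, nbhs k U &
    forall x y, U (e x) -> U (e y) -> B (g x, g y)) ->
  exists G : continuousType L Z, forall x, G (e x) = g x.
Proof.
move=> cZ inj_e dense_e gU.
have meet (k : L) (U : set L) : nbhs k U -> exists x, U (e x).
  rewrite nbhsE => -[V [oV Vk] VU].
  have [l [Vl [x _ xl]]] := dense_e V (ex_intro _ k Vk) oV.
  by exists x; rewrite xl; exact: VU.
(* [Z] need not be separated, so limits are not unique: on the range of [e] the value of [g] itself
   must be chosen, and injectivity makes that choice consistent. *)
have limit (k : L) : exists z, (forall x, e x = k -> g x = z) /\
    forall B, entourage B -> exists2 U : set L, nbhs k U &
      forall x, U (e x) -> B (z, g x).
  have [[x xk]|nk] := pselect (exists x, e x = k).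
    exists (g x); split => [y|B /gU-/(_ k)[U kU UB]].
      by rewrite -xk => /inj_e ->.
    exists U => // y; apply: UB; rewrite xk; exact: nbhs_singleton kU.
  pose F := filter_from (nbhs k) (fun U => g @` (e @^-1` U)).
  have FF : ProperFilter F.
    apply: filter_from_proper.
      apply: filter_from_filter; first by exists setT; exact: filterT.
      move=> U V kU kV; exists (U `&` V); first exact: filterI.
      by move=> _ [x [Ux Vx] <-]; split; exists x.
    by move=> U /meet[x Ux]; exists (g x); exists x.
  have [|z Fz] := cZ F FF.
    move=> B /gU-/(_ k)[U kU UB].
    exists (g @` (e @^-1` U), g @` (e @^-1` U)); first by split; exists U.
    by move=> [a b] /= [[x Ux <-] [y Uy <-]]; exact: UB.
  exists z; split => [x xk|B eB]; first by case: nk; exists x.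
  have [U kU UB] : F (xsection B z).
    by apply: Fz; rewrite -nbhs_entourageE; exists B.
  by exists U => // x Ux; apply/xsectionP/UB; exists x.
have {limit}[G GP] := choice limit.
have cG : continuous G.
  move=> k; apply/cvg_entourageP => B eB.
  pose D : set (Z * Z) := split_ent B `&` (split_ent B)^-1%relation.
  have eD : entourage D.
    by apply: filterI; [|apply: entourage_inv]; exact: entourage_split_ent.
  have [U kU UD] := (GP k).2 D eD.
  (* Since [U] is also a neighbourhood of [l], density gives an [e x] near both [k] and [l], and
     [g x] links [G k] to [G l]. *)
  have := nbhs_interior kU; apply: filterS => l lU.
  have [V lV VD] := (GP l).2 D eD.
  have [x [Ux Vx]] := meet l _ (filterI lU lV).
  have [? _] := UD _ Ux; have [_ ?] := VD _ Vx.
  exact: (entourage_split (g x)).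
by exists (mkcts cG) => x; rewrite ((GP (e x)).1 x).
Qed.

(** With finitely many factors, a point of an open set can be moved into the range one coordinate at
    a time without leaving that set. *)
Lemma dense_prod (n : nat) (X K : 'I_n -> topologicalType)
    (e : forall i, X i -> K i) :
  (forall i, dense (range (e i))) ->
  dense (range (fun x : prod_topology X =>
    (fun i => e i (x i)) : prod_topology K)).
Proof.
move=> dense_e U [k Uk] oU.
have approx m : (m <= n)%N -> exists2 p : prod_topology K, U p &
    forall i : 'I_n, (i < m)%N -> exists a, e i a = p i.
  elim: m => [_|m IHm lt_mn]; first by exists k.
  have [p Up pP] := IHm (ltnW lt_mn); pose j := Ordinal lt_mn.
  pose V : set (K j) := dfwith p j @^-1` U.
  have oV : open V.
    by apply: (continuousP _).1 oU; exact: dfwith_continuous.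
  have [|b [Vb [a _ ab]]] := dense_e j V _ oV.
    exists (p j); rewrite /V /=; congr (U _): Up.
    by apply: functional_extensionality_dep => i; case: dfwithP.
  exists (dfwith p j (e j a)) => [|i]; first by rewrite ab.
  rewrite ltnS leq_eqVlt.
  case: (dfwithP p (e j a) i) => [|i' ji' /orP[/eqP im|/pP //]].
    by exists a.
  by exfalso; move/eqP: ji'; apply; apply/val_inj.
have [p Up pP] := approx n (leqnn n).
exists p; split=> //; exists (fun i => projT1 (cid (pP i (ltn_ord i)))) => //.
by apply: functional_extensionality_dep => i; case: cid.
Qed.

(** Presents two points that differ only at [j] over the same remaining coordinates [q], so that a
    bound between slices applies to them. *)
Lemma insert_coordK {I : eqType} (X : I -> topologicalType) (j : I)
    (p q : prod_topology X) :
  (forall i, i != j -> p i = q i) ->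
  insert_coord (p j) (fun k : others j => q (val k)) = p.
Proof.
move=> pq; apply: functional_extensionality_dep => i.
have [->|ij] := eqVneq i j; first exact: insert_coord_at.
by rewrite (insert_coord_other (j := j) _ _ (exist _ i ij)) pq.
Qed.

Lemma prod_uniformly_cauchy (n : nat) (X K : 'I_n -> topologicalType)
    (e : forall i, X i -> K i) (Z : uniformType) (g : prod_topology X -> Z)
    (k : prod_topology K) :
  (forall j B, entourage B -> exists2 U : set (K j), nbhs (k j) U &
    forall a b, U (e j a) -> U (e j b) -> forall x,
      B (g (insert_coord a x), g (insert_coord b x))) ->
  forall B, entourage B -> exists2 U : set (prod_topology K), nbhs k U &
    forall x y : prod_topology X, U (fun i => e i (x i)) ->
      U (fun i => e i (y i)) -> B (g x, g y).
Proof.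
move=> gU.
(* Hybrids leading from [x] (at [m = 0]) to [y] (at [m = n]). Each step of the induction halves the
   entourage, hence [B] stays general. *)
pose mix m (x y : prod_topology X) : prod_topology X :=
  fun i => if (i < m)%N then y i else x i.
suff mixP m B : (m <= n)%N -> entourage B ->
    exists2 U : set (prod_topology K), nbhs k U &
    forall x y : prod_topology X, U (fun i => e i (x i)) ->
      U (fun i => e i (y i)) -> B (g x, g (mix m x y)).
  move=> B /(mixP n B (leqnn n))[U kU UB]; exists U => // x y Ux Uy.
  have <- : mix n x y = y.
    by apply: functional_extensionality_dep => i; rewrite /mix ltn_ord.
  exact: UB.
elim: m B => [|m IHm] B lt_mn eB.
  by exists setT; [exact: filterT|move=> x y _ _; exact: entourage_refl].
have eD := entourage_split_ent eB.
have [U kU UD] := IHm _ (ltnW lt_mn) eD.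
pose j := Ordinal lt_mn; have [V kV VD] := gU j _ eD.
exists (U `&` proj j @^-1` V) => [|x y [Ux Vx] [Uy Vy]].
  by apply: filterI => //; exact: (@proj_continuous _ K j k _ kV).
apply: (entourage_split _ eB (UD _ _ Ux Uy)).
(* Uniformity of the slice bound is used here: [V] was fixed before the hybrid, whose other
   coordinates vary with [x] and [y]. *)
have := VD _ _ Vx Vy (fun i : others j => mix m x y (val i)).
have -> : x j = mix m x y j by rewrite /mix ltnn.
rewrite insert_coordK//.
have -> : y j = mix m.+1 x y j by rewrite /mix ltnSn.
rewrite insert_coordK// => i ij.
by rewrite /mix ltnS leq_eqVlt (negPf (ij : i != m :> nat)).
Qed.

Theorem proposition3 (n : nat) (X K : 'I_n -> topologicalType)
    (iota : forall i : 'I_n, X i -> K i)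
    (compactK : forall i : 'I_n, compactification (iota i))
    (Z : uniformType) (completeZ : complete_uniform Z)
    (g : continuousType (prod_topology X) Z)
    (extendable : forall (j : 'I_n) (x : prod_others X j),
      exists h : continuousType (K j) Z,
        forall a : X j, h (iota j a) = g (insert_coord a x))
    (relatively_compact : forall j : 'I_n,
      precompact [set slice g a | a in [set: X j]]) :
  exists G : continuousType (prod_topology K) Z,
    forall x : prod_topology X, G (fun i => iota i (x i)) = g x.
Proof.
apply: (@dense_extension (prod_topology X) (prod_topology K) Z
  (fun x i => iota i (x i)) g) => //.
- move=> x y xy; apply: functional_extensionality_dep => i.
  by apply: (compactification_inj (compactK i)); exact: (f_equal (fun f => f i) xy).
- by apply: dense_prod => i; exact: compactification_dense (compactK i).
move=> k; apply: prod_uniformly_cauchy => j B.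
exact: precompact_range_uniformly_cauchy (relatively_compact j) (extendable j).
Qed.
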